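(* Let $\mathcal A$ be a finite alphabet, let $\varphi:\mathcal A^*\to\mathcal A^*$ be a primitive marked morphism, and let ${\bf u}\in\mathcal A^{\mathbb N}$ be a fixed point of $\varphi$ with $D({\bf u})<+\infty$. If all complete return words to all letters in ${\bf u}$ are palindromes, or if there exists a conjugate of $\varphi$ distinct from $\varphi$ itself, then $D({\bf u})=0$.
   Context: For a finite word $w$, $\widetilde w$ denotes its reversal; $w$ is a palindrome if $w=\widetilde w$. The palindromic defect of a finite word $w$ of length $n$ is $D(w)=n+1-(\text{number of distinct palindromic factors of } w$, the empty word included$)$. For an infinite word ${\bf u}$, $D({\bf u})=\sup\{D(w): w \text{ a factor of } {\bf u}\}$. A morphism $\varphi$ is primitive if there is $k$ such that every letter $b$ occurs in $\varphi^k(a)$ for every letter $a$. A fixed point of $\varphi$ is an infinite word ${\bf u}$ with $\varphi({\bf u})={\bf u}$. If $i<j$ are two consecutive occurrences of a factor $w=u_i\cdots u_{i+|w|-1}$ in ${\bf u}=u_0u_1\cdots$, then $u_iu_{i+1}\cdots u_{j+|w|-1}$ is a complete return word to $w$ in ${\bf u}$. A morphism $\psi$ is a left conjugate of $\varphi$ (and $\varphi$ a right conjugate of $\psi$), written $\psi\triangleright\varphi$, if there is $w\in\mathcal A^*$ with $\varphi(a)w=w\psi(a)$ for all $a\in\mathcal A$; a conjugate of $\varphi$ is any left or right conjugate of $\varphi$. A morphism is cyclic if there is $w$ with $\varphi(a)\in w^*$ for all letters $a$, and acyclic otherwise. For an acyclic morphism $\varphi$, its leftmost conjugate $\varphi_L$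 is the left conjugate $\psi$ of $\varphi$ for which the map $\textsc{Fst}(\psi):a\mapsto$ first letter of $\psi(a)$ is not constant, and its rightmost conjugate $\varphi_R$ is the right conjugate $\psi$ of $\varphi$ for which the map $\textsc{Lst}(\psi):a\mapsto$ last letter of $\psi(a)$ is not constant. An acyclic morphism $\varphi$ is marked if $\textsc{Fst}(\varphi_L)$ and $\textsc{Lst}(\varphi_R)$ are injective. *)

(* Defs.v *)
(* Words over a finite alphabet A are seq A;
   infinite words are functions nat -> A; morphisms are given by their
   images of letters, phi : A -> seq A, extended to words by concatenation. *)
From mathcomp Require Import all_boot.
Set Implicit Arguments. Unset Strict Implicit. Unset Printing Implicit Defensive.

Section Words.
Variable A : finType.

Definition mapw (phi : A -> seq A) (w : seq A) : seq A := flatten (map phi w).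

Definition palindrome (w : seq A) : bool := w == rev w.

Definition all_factors (w : seq A) : seq (seq A) :=
  [seq take j (drop i w) | i <- iota 0 (size w).+1, j <- iota 0 (size w).+1].

Definition pal_factors (w : seq A) : seq (seq A) :=
  undup [seq x <- all_factors w | palindrome x].

Definition defect (w : seq A) : nat := (size w).+1 - size (pal_factors w).

Definition ufactor (u : nat -> A) (i n : nat) : seq A := mkseq (fun k => u (i + k)) n.

Definition finite_defect (u : nat -> A) : Prop :=
  exists B : nat, forall i n, defect (ufactor u i n) <= B.

Definition zero_defect (u : nat -> A) : Prop :=
  forall i n, defect (ufactor u i n) = 0.

Definition primitive (phi : A -> seq A) : Prop :=
  exists k, forall a b : A, b \in iter k (mapw phi) [:: a].

(* u is a fixed point of phi: phi(u) = u, i.e. the infinite concatenation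
   phi(u_0) phi(u_1) ... is an infinite word equal to u *)
Definition fixed_point (phi : A -> seq A) (u : nat -> A) : Prop :=
  (forall n, let p := mapw phi (ufactor u 0 n) in p = ufactor u 0 (size p)) /\
  (forall m, exists n, m <= size (mapw phi (ufactor u 0 n))).

Definition all_return_words_to_letters_pal (u : nat -> A) : Prop :=
  forall i j, i < j -> u i = u j -> (forall k, i < k < j -> u k <> u i) ->
    palindrome (ufactor u i (j - i).+1).

Definition left_conj (psi phi : A -> seq A) : Prop :=
  exists w : seq A, forall a, phi a ++ w = w ++ psi a.

Definition conjugate (psi phi : A -> seq A) : Prop :=
  left_conj psi phi \/ left_conj phi psi.

Definition cyclic (phi : A -> seq A) : Prop :=
  exists w : seq A, forall a, exists k, phi a = flatten (nseq k w).

Definition acyclic (phi : A -> seq A) : Prop := ~ cyclic phi.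

Definition Fst (psi : A -> seq A) (a : A) : option A := ohead (psi a).
Definition Lst (psi : A -> seq A) (a : A) : option A := ohead (rev (psi a)).

Definition nonconstant (f : A -> option A) : Prop := exists a b, f a <> f b.

Definition is_leftmost_conj (psi phi : A -> seq A) : Prop :=
  left_conj psi phi /\ nonconstant (Fst psi).
Definition is_rightmost_conj (psi phi : A -> seq A) : Prop :=
  left_conj phi psi /\ nonconstant (Lst psi).

Definition marked (phi : A -> seq A) : Prop :=
  acyclic phi /\
  (exists psiL, is_leftmost_conj psiL phi /\ injective (Fst psiL)) /\
  (exists psiR, is_rightmost_conj psiR phi /\ injective (Lst psiR)).

End Words.

(* Main.v *)
Require Import Defs.
From mathcomp Require Import all_boot zify_ssreflect.
From Stdlib Require Import Lia Classical.
Set Implicit Arguments. Unset Strict Implicit. Unset Printing Implicit Defensive.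

(* Call "return words to v" the factors delimited by two consecutive occurrences
   of elements of {v, rev v}.  Finite defect makes all return words to long
   factors palindromic, and the defect is zero as soon as this holds for all
   factors.  Consider the graph on the pairs (a, v), with v ranging over
   {w, rev w}, in which (a, v) and (b, rev v) are adjacent when a v b is a factor
   of u.  If some return word is not a palindrome, a shortest one taken with the
   longest possible v = a t shows a cycle through (a, t) in the graph of t;
   conversely such a cycle is impossible when the return words to the words of
   length |t| + 1 are palindromes, since the Rauzy graph of that order modulo
   reversal is then a tree up to loops.
   For a marked morphism, w |-> phi_R(w) W = W phi_L(w) maps bispecial factors
   to bispecial factors and permutes their extensions; a suitable power Psi of it
   fixes the extensions, hence moves a cycle to arbitrarily long factors, except
   when w and W are both empty.  A cycle of a non-palindrome could be lost when
   its image is a palindrome; but then either Psi commutes with reversal, or Psi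
   sends no palindrome containing all letters to a palindrome, so that
   non-palindromes recur among the iterates.  The hypothesis on letters, or the
   existence of a second conjugate (which gives W <> [::]), excludes the cycles
   of the empty word. *)

(* The views of mathcomp yield words over the eqType underlying A; restating
   them over A itself keeps all sizes syntactically equal, as lia requires. *)
Section FactorViews.
Variable A : finType.
Implicit Types s t : seq A.

Lemma is_suffixP s t : reflect (exists y : seq A, t = y ++ s) (suffix s t).
Proof. exact: suffixP. Qed.

Lemma is_prefixP s t : reflect (exists y : seq A, t = s ++ y) (prefix s t).
Proof. exact: prefixP. Qed.

Lemma is_infixP s t : reflect (exists y z : seq A, t = y ++ s ++ z) (infix s t).
Proof. exact: infixP. Qed.

Lemma catI s t y z : size s = size t -> s ++ y = t ++ z -> s = t /\ y = z.
Proof. by move=> e /eqP; rewrite eqseq_cat // => /andP[/eqP-> /eqP->]. Qed.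

End FactorViews.

(** * Factors of an infinite word and their occurrences modulo reversal *)

Section InfiniteWord.
Variables (A : finType) (u : nat -> A).
Implicit Types (v w : seq A) (i j k l m n p q s : nat).

Lemma size_ufactor i n : size (ufactor u i n) = n.
Proof. by rewrite size_mkseq. Qed.

Lemma nth_ufactor x0 i n k : k < n -> nth x0 (ufactor u i n) k = u (i + k).
Proof. exact: nth_mkseq. Qed.

Lemma ufactorD i m n : ufactor u i (m + n) = ufactor u i m ++ ufactor u (i + m) n.
Proof.
rewrite /ufactor /mkseq iotaD map_cat add0n; congr (_ ++ _).
by rewrite -[m in iota m n]addn0 iotaDl -map_comp; apply: eq_map => k /=; rewrite addnA.
Qed.

Lemma ufactorS i n : ufactor u i n.+1 = u i :: ufactor u i.+1 n.
Proof. by rewrite -add1n ufactorD addn1 /ufactor /mkseq /= addn0. Qed.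

Lemma ufactorSr i n : ufactor u i n.+1 = rcons (ufactor u i n) (u (i + n)).
Proof. by rewrite -addn1 ufactorD cats1 /ufactor /mkseq /= addn0. Qed.

Lemma ufactor_rcons i n w a :
  ufactor u i n.+1 = rcons w a -> ufactor u i n = w /\ u (i + n) = a.
Proof. by rewrite ufactorSr => /rcons_inj[-> ->]. Qed.

Lemma ufactor_eqP i j n :
  ufactor u i n = ufactor u j n <-> (forall k, k < n -> u (i + k) = u (j + k)).
Proof.
split=> [e k kn|e].
  by rewrite -(nth_ufactor (u 0) i kn) e nth_ufactor.
apply: (@eq_from_nth _ (u 0)); rewrite !size_ufactor // => k kn.
by rewrite !nth_ufactor // e.
Qed.

Lemma ufactor_revP i j n :
  ufactor u j n = rev (ufactor u i n) <->
  (forall k l, (k + l).+1 = n -> u (j + k) = u (i + l)).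
Proof.
split=> [e k l kln|e].
  have kn : k < n by lia.
  rewrite -(nth_ufactor (u 0) j kn) e nth_rev ?size_ufactor // nth_ufactor; last lia.
  by congr u; lia.
apply: (@eq_from_nth _ (u 0)); rewrite ?size_rev !size_ufactor // => k kn.
rewrite nth_rev ?size_ufactor // !nth_ufactor; try lia.
by apply: e; lia.
Qed.

Lemma ufactor_sub i j n k m :
  ufactor u i n = ufactor u j n -> k + m <= n ->
  ufactor u (i + k) m = ufactor u (j + k) m.
Proof.
move/ufactor_eqP=> e kmn; apply/ufactor_eqP => h hm.
by rewrite -!addnA; apply: e; lia.
Qed.

(** For [i = j] this is the symmetry of a palindromic factor: the block starting [k] letters after
    its left end mirrors the one ending [k] letters before its right end. *)
Lemma ufactor_mirror i j n k l m :
  ufactor u j n = rev (ufactor u i n) -> k + l + m = n ->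
  ufactor u (j + k) m = rev (ufactor u (i + l) m).
Proof.
move/ufactor_revP=> e kmn; apply/ufactor_revP => h h' hm.
by rewrite -!addnA; apply: e; lia.
Qed.

Definition occ v p := ufactor u p (size v) \in [:: v; rev v].

Lemma mem_rev2 v w : (rev w \in [:: v; rev v]) = (w \in [:: v; rev v]).
Proof. by rewrite !inE (can_eq revK) (can2_eq revK revK) orbC. Qed.

Lemma occ_rev v p : occ (rev v) p = occ v p.
Proof. by rewrite /occ size_rev revK !inE orbC. Qed.

Lemma occ_shift v i j n k :
  ufactor u i n = ufactor u j n -> k + size v <= n -> occ v (i + k) = occ v (j + k).
Proof. by move=> e kn; rewrite /occ (ufactor_sub e kn). Qed.

Lemma occ_mirror v i j n k l :
  ufactor u j n = rev (ufactor u i n) -> k + l + size v = n ->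
  occ v (j + k) = occ v (i + l).
Proof. by move=> e kn; rewrite /occ (ufactor_mirror e kn) mem_rev2. Qed.

Definition fac w := exists i, ufactor u i (size w) = w.

Lemma fac_ufactor i n : fac (ufactor u i n).
Proof. by exists i; rewrite size_ufactor. Qed.

Lemma infix_ufactorP (x : seq A) i n :
  reflect (exists2 j, i <= j <= i + n - size x & size x <= n /\ ufactor u j (size x) = x)
          (infix x (ufactor u i n)).
Proof.
apply: (iffP idP) => [/is_infixP[y [z e]]|[j ij [xn <-]]].
  have /(congr1 size) := e; rewrite size_ufactor !size_cat => en.
  exists (i + size y); first lia.
  split; first lia.
  move: e; rewrite en !ufactorD.
  by move/catI; rewrite size_ufactor => -[] // _ /catI; rewrite size_ufactor => -[].
apply/is_infixP; exists (ufactor u i (j - i)), (ufactor u (j + size x) (i + n - j - size x)).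
have {1}-> : n = (j - i) + (size x + (i + n - j - size x)) by lia.
rewrite !ufactorD; have -> : i + (j - i) = j by lia.
by [].
Qed.

Lemma fac_infix (x w : seq A) : infix x w -> fac w -> fac x.
Proof.
by move=> xw [i wi]; move: xw; rewrite -wi => /infix_ufactorP[j _ [_ e]]; exists j.
Qed.

Definition ret_pal v := forall p q, p < q -> occ v p -> occ v q ->
  (forall s, p < s < q -> ~~ occ v s) -> palindrome (ufactor u p (q - p + size v)).

End InfiniteWord.

Ltac nlia :=
  repeat match goal with
  | H : context [@mem] |- _ => clear H
  | H : context [@cons] |- _ => clear H
  | H : context [ufactor] |- _ => clear H
  | H : context [occ] |- _ => clear H
  end; lia.

(** * Defect and new palindromes *)

Section Defect.
Variables (A : finType).
Implicit Types (v w x s : seq A).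

Lemma mem_pal_factors w x : (x \in pal_factors w) = palindrome x && infix x w.
Proof.
rewrite mem_undup mem_filter; congr (_ && _).
apply/allpairsP/is_infixP => /= [[[i j] /= [_ _ ->]]|[y [z ew]]].
  apply/is_infixP; apply: (@infix_trans _ (drop i w)); first exact: infix_take.
  exact: infix_drop.
exists (size y, size x); rewrite ew /= in_cons mem_iota in_cons mem_iota !size_cat.
split; try lia.
by rewrite drop_size_cat // take_size_cat.
Qed.

Definition new_pal w a s := [&& palindrome s, suffix s (rcons w a) & ~~ infix s w].

(** A palindromic suffix of a longer palindromic suffix is also a prefix of it, hence already occurs
    in [w]. So a letter adds at most one palindrome. *)
Lemma new_pal_uniq w a s t : new_pal w a s -> new_pal w a t -> size s <= size t -> s = t.
Proof.
move=> /and3P[/eqP ps ss sw] /and3P[/eqP pt ts _] st.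
case: (eqVneq (size s) (size t)) => [e|ne].
  case/is_suffixP: ss => y ey; case/is_suffixP: ts => z ez.
  have e2 : y ++ s = z ++ t by rewrite -ey ez.
  have := congr1 size e2; rewrite !size_cat => e3.
  by have [] : y = z /\ s = t by apply: catI e2; lia.
case/negP: sw.
case/is_suffixP: ss => y ey; case/is_suffixP: ts => z ez.
have st2 : suffix s t.
  apply/is_suffixP; exists (drop (size z) y).
  have ed : drop (size z) (y ++ s) = t by rewrite -ey ez drop_size_cat.
  have := congr1 size ez; rewrite ey !size_cat => e2.
  by rewrite -ed drop_cat; case: ltnP => // h; lia.
have : prefix s t by rewrite -prefix_rev in st2 *; rewrite ps pt.
case/is_prefixP=> y' et; have : 0 < size y' by move: ne; rewrite et size_cat; lia.
case/lastP: y' et => // y' b et _.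
move: ez; rewrite et -!rcons_cat => /rcons_inj[-> _].
by apply/is_infixP; exists z, y'.
Qed.

Lemma size_pal_factors_rcons w a :
  size (pal_factors w) <= size (pal_factors (rcons w a)) <= (size (pal_factors w)).+1.
Proof.
apply/andP; split.
  apply: uniq_leq_size; first exact: undup_uniq.
  move=> x; rewrite !mem_pal_factors => /andP[-> /=] xw.
  by rewrite infix_rconsl xw orbT.
have [/hasP[s _ ns]|/hasPn nn] := boolP (has (new_pal w a) (pal_factors (rcons w a))).
  rewrite -/(size (s :: pal_factors w)).
  apply: uniq_leq_size; first exact: undup_uniq.
  move=> x; rewrite mem_pal_factors in_cons mem_pal_factors => /andP[px].
  rewrite infix_rconsl px; case: (boolP (infix x w)) => [_ _|xw /=]; first by rewrite orbT.
  rewrite orbF => sx.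
  have nx : new_pal w a x by rewrite /new_pal px sx xw.
  rewrite orbF; apply/eqP; case: (leqP (size x) (size s)) => h.
    exact: (new_pal_uniq nx ns).
  by rewrite (new_pal_uniq ns nx) // ltnW.
apply: leqW; apply: uniq_leq_size; first exact: undup_uniq.
move=> x xp; move: (nn x xp) (xp); rewrite !mem_pal_factors /new_pal infix_rconsl.
by case: (palindrome x); case: (infix x w); case: (suffix x _).
Qed.

Lemma new_palP w a :
  reflect (exists s, new_pal w a s)
          (size (pal_factors (rcons w a)) == (size (pal_factors w)).+1).
Proof.
apply: (iffP eqP) => [e|[s ns]].
  have [/hasP[s _ ns]|/hasPn nn] := boolP (has (new_pal w a) (pal_factors (rcons w a))).
    by exists s.
  suff: size (pal_factors (rcons w a)) <= size (pal_factors w) by lia.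
  apply: uniq_leq_size; first exact: undup_uniq.
  move=> x xp; move: (nn x xp) (xp); rewrite !mem_pal_factors /new_pal infix_rconsl.
  by case: (palindrome x); case: (infix x w); case: (suffix x _).
apply/eqP; rewrite eqn_leq; case/andP: (size_pal_factors_rcons w a) => _ -> /=.
have /and3P[ps ss sw] := ns.
rewrite -/(size (s :: pal_factors w)); apply: uniq_leq_size.
  by rewrite /= undup_uniq mem_pal_factors (negbTE sw) andbF.
move=> x; rewrite in_cons !mem_pal_factors => /orP[/eqP->|/andP[-> xw]].
  by rewrite ps infix_rconsl ss.
by rewrite infix_rconsl xw orbT.
Qed.

Lemma size_pal_factors w : size (pal_factors w) <= (size w).+1.
Proof.
elim/last_ind: w => [|w a IH]; first by [].
by have /andP[_] := size_pal_factors_rcons w a; rewrite size_rcons; lia.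
Qed.

Variable u : nat -> A.

Definition new_pal_at i m := exists j, [/\ i <= j <= i + m,
  palindrome (ufactor u j ((i + m).+1 - j)) &
  forall k, i <= k < j -> ufactor u k ((i + m).+1 - j) <> ufactor u j ((i + m).+1 - j)].

Lemma new_pal_atP i m :
  new_pal_at i m <-> exists s, new_pal (ufactor u i m) (u (i + m)) s.
Proof.
rewrite /new_pal -ufactorSr; split=> [[j [ij pj nj]]|[s /and3P[ps /is_suffixP[y ey] /negP sw]]].
  exists (ufactor u j ((i + m).+1 - j)); rewrite pj /=; apply/andP; split.
    apply/is_suffixP; exists (ufactor u i (j - i)).
    have {1}-> : m.+1 = (j - i) + ((i + m).+1 - j) by lia.
    by rewrite ufactorD; congr (_ ++ ufactor _ _ _); lia.
  apply/negP => /infix_ufactorP[k]; rewrite size_ufactor => ik [h e].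
  by apply: (nj k); first lia.
have esz := congr1 size ey; rewrite size_ufactor size_cat in esz.
have s0 : 0 < size s by rewrite lt0n size_eq0; apply/eqP => s0; apply: sw; rewrite s0 infix0s.
have ej : (i + m).+1 - (i + size y) = size s by lia.
have es : ufactor u (i + size y) (size s) = s.
  move: ey; rewrite esz ufactorD => /eqP.
  by rewrite eqseq_cat ?size_ufactor // => /andP[_ /eqP].
exists (i + size y); rewrite ej es; split=> //; first lia.
move=> k kj ek; apply: sw; apply/infix_ufactorP; exists k; first lia.
by split=> //; lia.
Qed.

Lemma defect_step i m : defect (ufactor u i m) <= defect (ufactor u i m.+1).
Proof.
rewrite /defect !size_ufactor ufactorSr.
have /andP[_] := size_pal_factors_rcons (ufactor u i m) (u (i + m)).
have := size_pal_factors (ufactor u i m); rewrite size_ufactor; lia.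
Qed.

Lemma defect_stepP i m :
  defect (ufactor u i m.+1) = defect (ufactor u i m) <-> new_pal_at i m.
Proof.
rewrite new_pal_atP /defect !size_ufactor ufactorSr.
have := size_pal_factors_rcons (ufactor u i m) (u (i + m)).
have := size_pal_factors (ufactor u i m); rewrite size_ufactor => h1 /andP[h2 h3].
split=> [e|/new_palP/eqP->]; last lia.
by apply/new_palP/eqP; lia.
Qed.

End Defect.

(** * Return words and defect *)

Section Returns.
Variables (A : finType) (u : nat -> A).
Implicit Types (v w x : seq A).

(** The longest palindromic suffix of a factor is new: the return word from its last earlier
    occurrence would be a longer palindromic suffix. *)
Lemma ret_pal_zero_defect : (forall v, ret_pal u v) -> zero_defect u.
Proof.
move=> R i; elim=> [|m <-]; first by rewrite /defect size_ufactor.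
apply/defect_stepP.
pose P j := (i <= j) && palindrome (ufactor u j ((i + m).+1 - j)).
have exP : exists j, P j.
  by exists (i + m); rewrite /P leq_addr subSn // subnn; apply/eqP.
case: (ex_minnP exP) => j /andP[ij pj] minj.
have jm : j <= i + m.
  by apply: minj; rewrite /P leq_addr subSn // subnn; apply/eqP.
exists j; split=> //; first by rewrite ij.
move=> k /andP[ik kj] ek.
set L := (i + m).+1 - j in pj ek; set s := ufactor u j L in pj ek.
have szs : size s = L by rewrite size_ufactor.
have exQ : exists k, (k < j) && occ u s k.
  by exists k; rewrite kj /occ szs ek inE eqxx.
case: (ex_maxnP exQ (m := j)) => [h /andP[/ltnW]//|h /andP[hj oh] maxh].
have kh : k <= h by apply: maxh; rewrite kj /occ szs ek inE eqxx.
have oj : occ u s j by rewrite /occ szs inE eqxx.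
have pal := R s h j hj oh oj.
suff: j <= h by lia.
apply: minj; rewrite /P (leq_trans ik kh) /=.
rewrite (_ : _ - h = j - h + size s); last by rewrite szs /L; lia.
apply: pal => t /andP[ht tj]; apply/negP => ot.
by have := maxh t; rewrite tj ot => /(_ isT); lia.
Qed.

(** Defects of prefixes never decrease, so bounded ones change only finitely often. *)
Lemma finite_defect_new_pal :
  finite_defect u -> exists n, forall m, n <= m -> new_pal_at u 0 m.
Proof.
case=> B dB; apply: NNPP => no.
have step d : exists m, d <= defect (ufactor u 0 m).
  elim: d => [|d [n dn]]; first by exists 0.
  have [m nm_new] := not_all_ex_not _ _ (fun h => no (ex_intro _ n h)).
  have [nm nnew] := imply_to_and _ _ nm_new.
  exists m.+1; have := defect_step u 0 m.
  have : defect (ufactor u 0 n) <= defect (ufactor u 0 m).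
    elim: m nm {nnew nm_new} => [|m IH] h; first by have -> : n = 0 by lia.
    case: (ltnP m n) => mn; first by have -> : n = m.+1 by lia.
    exact: leq_trans (IH mn) (defect_step _ _ _).
  have : defect (ufactor u 0 m.+1) <> defect (ufactor u 0 m) by move/defect_stepP.
  lia.
by case: (step B.+1) => m; have := dB 0 m; lia.
Qed.

Lemma palindrome_mirror p n :
  palindrome (ufactor u p n) -> ufactor u p n = rev (ufactor u p n).
Proof. by move/eqP. Qed.

(** Move the return word to its first occurrence [p] modulo reversal, and let [j] be the start of
    the new palindrome ending where it ends. By symmetry [v] occurs at [j] modulo reversal; the
    minimality of [p] and the absence of occurrences between [p] and [q] leave [j = p]. *)
Lemma new_pal_ret_pal n v :
  (forall m, n <= m -> new_pal_at u 0 m) -> n <= size v -> ret_pal u v.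
Proof.
move=> new nv p0 q0 pq0 op0 oq0 cons0.
set L := q0 - p0 + size v; set r := ufactor u p0 L.
have szr : size r = L by rewrite size_ufactor.
have exr : exists p, occ u r p by exists p0; rewrite /occ szr inE eqxx.
case: (ex_minnP exr) => p rp minp; set q := p + (q0 - p0).
have [op oq cons palr] : [/\ occ u v p, occ u v q,
    forall s, p < s < q -> ~~ occ u v s &
    palindrome (ufactor u p L) -> palindrome r].
  move: rp; rewrite {1}/occ szr !inE => /orP[]/eqP e.
    have sh k : k + size v <= L -> occ u v (p + k) = occ u v (p0 + k).
      exact: occ_shift.
    split.
    - by rewrite -[p]addn0 sh ?addn0 //; lia.
    - by rewrite /q sh; [have -> : p0 + (q0 - p0) = q0 by lia|lia].
    - move=> s sb; have -> : s = p + (s - p) by lia.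
      by rewrite sh; [apply: cons0; lia|lia].
    - by rewrite e.
  have sh k : k + size v <= L -> occ u v (p + k) = occ u v (p0 + (L - size v - k)).
    by move=> h; apply: (occ_mirror e); lia.
  split.
  - rewrite -[p]addn0 sh; last lia.
    by have -> : p0 + (L - size v - 0) = q0 by lia.
  - by rewrite /q sh; [have -> : p0 + (L - size v - (q0 - p0)) = p0 by lia|lia].
  - move=> s sb; have -> : s = p + (s - p) by lia.
    by rewrite sh; [apply: cons0; lia|lia].
  - by rewrite e /palindrome revK eq_sym.
apply: palr.
have pq : p < q by lia.
have [j []] : new_pal_at u 0 (q + size v).-1 by apply: new; lia.
have -> : (0 + (q + size v).-1).+1 = q + size v by lia.
set M := q + size v - j => jb pj nj.
have eM : M + j = q + size v by lia.
have mir := palindrome_mirror pj.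
(* A palindrome inside the occurrence at [q] would also lie in the one at [p], hence not be new. *)
have jq : j < q.
  rewrite ltnNge; apply/negP => qj.
  move: op oq; rewrite /occ.
  set x := ufactor u p _; set y := ufactor u q _ => xv yv.
  have [exy|exy] : x = y \/ x = rev y.
    move: xv yv; rewrite !inE => /orP[]/eqP-> /orP[]/eqP->; rewrite ?revK; by [left|right].
  - apply: (nj (p + (j - q))); first lia.
    have {2}-> : j = q + (j - q) by lia.
    by apply: ufactor_sub exy _; lia.
  apply: (nj p); first lia.
  rewrite mir -[p in LHS]addn0 (ufactor_mirror (l := j - q) exy); last lia.
  by congr (rev (ufactor _ _ _)); lia.
have ov : occ u v (j + 0).
  by rewrite (occ_mirror (l := q - j) mir); [have -> : j + (q - j) = q by lia|lia].
rewrite addn0 in ov.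
case: (ltngtP j p) => [jp|pj'|jp].
- have rj : occ u r (j + 0).
    rewrite (occ_mirror (l := p - j) mir); last by rewrite szr; lia.
    by have -> : j + (p - j) = p by lia.
  by have := minp _ rj; lia.
- by have := cons j; rewrite pj' jq ov => /(_ isT).
by rewrite -jp (_ : L = M) //; lia.
Qed.

(** A long prefix [P] recurs; the new palindrome ending with the second copy is not short, or it
    would lie in the first copy. So it contains [w], hence [rev w]. *)
Lemma new_pal_rev_closed n :
  (forall m, n <= m -> new_pal_at u 0 m) ->
  (forall w k, fac u w -> exists2 i, k <= i & ufactor u i (size w) = w) ->
  (forall w, fac u w -> exists N, forall i, infix w (ufactor u i N)) ->
  forall w, fac u w -> fac u (rev w).
Proof.
move=> new rec urec w /urec[N wN].
set P := ufactor u 0 (n + N).+1.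
have [x x0] := rec P 1 (fac_ufactor _ _ _); rewrite size_ufactor => ePx.
have [j []] : new_pal_at u 0 (x + n + N) by apply: new; lia.
rewrite add0n; set M := (x + n + N).+1 - j => jb pj nj.
have NM : N <= M.
  rewrite leqNgt; apply/negP => MN.
  apply: (nj (j - x)); first lia.
  have := ufactor_sub (k := j - x) (m := M) ePx; rewrite add0n => <-; last lia.
  by congr ufactor; lia.
apply: fac_infix (fac_ufactor u j M).
rewrite (palindrome_mirror pj) infix_rev.
apply: (@infix_trans _ (ufactor u j N)) => //.
have -> : M = N + (M - N) by lia.
by rewrite ufactorD; apply: prefix_infix.
Qed.

End Returns.

(** * Cycles in extension graphs *)

Section Cycles.
Variables (V : Type) (e : V -> V -> Prop).

Inductive reach (ok : V -> Prop) (x : V) : V -> Prop :=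
| reach_refl : ok x -> reach ok x x
| reach_step y z : reach ok x y -> e y z -> ok z -> reach ok x z.

(** Loops at [d] do not count: the walk avoids [d], so [y] and [z] differ from it. *)
Definition cycle_at d :=
  exists y z, [/\ e d y, e d z, y <> z & reach (fun x => x <> d) y z].

Lemma reach_ok ok x y : reach ok x y -> ok y.
Proof. by case. Qed.

Lemma reach_start ok x y : reach ok x y -> ok x.
Proof. by elim. Qed.

Lemma reach_trans ok x y z : reach ok x y -> reach ok y z -> reach ok x z.
Proof.
move=> xy; elim=> [//|y' z' _ xy' e' okz]; exact: reach_step xy' e' okz.
Qed.

End Cycles.

(** [P] holds along the whole cycle; injectivity of [f] there keeps the image walk off [f d] and its
    ends distinct. *)
Lemma cycle_at_map (V W : Type) (e : V -> V -> Prop) (e' : W -> W -> Prop)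
    (f : V -> W) (P : V -> Prop) d :
  (forall x y, P x -> e x y -> P y) ->
  (forall x y, P x -> e x y -> e' (f x) (f y)) ->
  (forall x y, P x -> P y -> f x = f y -> x = y) ->
  P d -> cycle_at e d -> cycle_at e' (f d).
Proof.
move=> inv hom inj Pd [y [z [dy dz yz r]]].
exists (f y), (f z); split; [exact: hom|exact: hom| |].
  by move=> /inj fyz; apply: yz; apply: fyz; [exact: inv dy|exact: inv dz].
suff: P z /\ reach e' (fun x => x <> f d) (f y) (f z) by case.
elim: r => [yd|z1 z2 _ [Pz1 r1] e12 z2d].
  split; first exact: inv dy.
  by constructor=> /inj h; apply: yd; apply: h => //; exact: inv dy.
have Pz2 := inv _ _ Pz1 e12; split=> //.
by apply: reach_step r1 (hom _ _ Pz1 e12) _ => /inj h; apply: z2d; apply: h.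
Qed.

Lemma cons_rcons_nseq (T : eqType) (x : T) s :
  x :: s = rcons s x -> s = nseq (size s) x.
Proof. by elim: s => //= y s IH [<- e]; rewrite -IH. Qed.

(** * Absence of cycles when return words are palindromes *)

Section Forest.
Variables (A : finType) (u : nat -> A).
Implicit Types (v w x : seq A) (s t d y z : A * seq A).

Definition link s t := t.2 = rev s.2 /\ fac u (s.1 :: rcons s.2 t.1).

Let vword s := s.1 :: s.2.

(** If [a :: v] is the reversal of [b :: w], counting letters gives [a = b]; when moreover
    [v = rev w], the word [v] is a power of [a]. *)
Lemma vword_inj s t : s.2 \in [:: t.2; rev t.2] ->
  vword s \in [:: vword t; rev (vword t)] -> s = t.
Proof.
case: s t => [a v] [b w]; rewrite /vword !inE /= => vw /orP[/eqP[-> ->//]|/eqP e].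
have ab : a = b.
  have vwp : perm_eq v w by case/orP: vw => /eqP->; rewrite ?perm_rev.
  have /permP/(_ (pred1 a)) : perm_eq (a :: v) (b :: w) by rewrite e perm_rev.
  move/permP/(_ (pred1 a)): vwp => evw; rewrite /= evw eqxx.
  by case: eqP => [->//|_ /eqP]; rewrite eqn_add2r.
subst b; case/orP: vw => /eqP ev; first by rewrite ev.
move: e; rewrite rev_cons -ev => /cons_rcons_nseq h.
suff: w = v by move->.
by rewrite -[w]revK -ev h rev_nseq.
Qed.

Variables (N : nat) (d : A * seq A).
Hypotheses (dN : (size d.2).+1 = N)
  (recur : forall w k, fac u w -> exists2 i, k <= i & ufactor u i (size w) = w)
  (ret : forall x, size x = N -> ret_pal u x).

(* Removing the class of [vword d] from the Rauzy graph of order N modulo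
   reversal, the component of a position p is remembered by the class [c] of
   the word through which the last passage at [vword d] was left. *)
Let color p c := exists q, [/\ q <= p, occ u (vword d) q,
  forall k, q < k <= p -> ~~ occ u (vword d) k &
  ufactor u q.+1 N \in [:: c; rev c]].

(** Between consecutive visits to the class of [x] a palindrome is read, so [vword d] is last left
    towards the neighbour from which it was first entered. The palindromic return word to [vword d]
    before that shows that this is the neighbour of the previous exit. *)
Lemma color_const x p p' c : size x = N ->
  x \notin [:: vword d; rev (vword d)] ->
  p < p' -> occ u x p -> occ u x p' -> color p c -> color p' c.
Proof.
move=> xN xd pp'.
have noocc k : occ u x k -> ~~ occ u (vword d) k.
  rewrite /occ /= dN xN => xk; apply: contra xd => dk.
  move: xk dk; rewrite !inE => /orP[]/eqP->; rewrite ?revK //.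
  by rewrite (can_eq revK) (can2_eq revK revK) orbC.
have [n le_n] := ubnP (p' - p); elim: n p p' pp' le_n => // n IH p p' pp' le_n xp xp' cp.
have [/hasP[k]|/hasPn cons] := boolP (has (occ u x) (iota p.+1 (p' - p.+1))).
  rewrite mem_iota => kb xk; apply: (IH k); try nlia; try done.
  by apply: (IH p); try nlia.
have pal1 : palindrome (ufactor u p (p' - p + N)).
  rewrite -xN; apply: ret => // k kb; apply: cons; rewrite mem_iota; nlia.
have m1 : ufactor u p (p' - p + N) = rev (ufactor u p (p' - p + N)) by apply/eqP.
have [q [qp oq lastq eq]] := cp.
have [/hasP[k0]|/hasPn nod] := boolP (has (occ u (vword d)) (iota p.+1 (p' - p))); last first.
  exists q; split=> //; first nlia.
  move=> k kb; case: (leqP k p) => kp; first by apply: lastq; nlia.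
  by apply: nod; rewrite mem_iota; nlia.
rewrite mem_iota => k0b ok0.
have ex0 : exists k, (p < k) && occ u (vword d) k by exists k0; rewrite ok0; nlia.
case: (ex_minnP ex0) => q0 /andP[pq0 oq0] minq0.
have ex1 : exists k, (k <= p') && occ u (vword d) k by exists k0; rewrite ok0; nlia.
case: (ex_maxnP ex1 (m := p')) => [k /andP[]//|q' /andP[qp' oq'] maxq'].
have h1 : q0 <= k0 by apply: minq0; rewrite ok0; nlia.
have h2 : k0 <= q' by apply: maxq'; rewrite ok0; nlia.
have h3 : q' <> p' by move=> E; have := noocc _ xp'; rewrite -E oq'.
have szd : size (vword d) = N by rewrite /= dN.
(* By symmetry, the first visit [q0] and the last visit [q'] satisfy [q0 + q' = p + p']. *)
have h4 : p + p' - q0 <= q'.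
  apply: maxq'; have -> : p + p' - q0 = p + (p' - q0) by nlia.
  rewrite (occ_mirror (l := q0 - p) m1) ?szd; last nlia.
  by rewrite subnKC ?oq0 ?andbT; nlia.
have h5 : q0 <= p + p' - q'.
  apply: minq0; have -> : p + p' - q' = p + (p' - q') by nlia.
  rewrite (occ_mirror (l := q' - p) m1) ?szd; last nlia.
  by rewrite subnKC ?oq' ?andbT; nlia.
have pal2 : palindrome (ufactor u q (q0 - q + N)).
  rewrite -szd; apply: ret => //; first nlia.
  move=> k kb; case: (leqP k p) => kp; first by apply: lastq; nlia.
  by apply/negP => ok; have := minq0 k; rewrite ok kp => /(_ isT); nlia.
have m2 : ufactor u q (q0 - q + N) = rev (ufactor u q (q0 - q + N)) by apply/eqP.
exists q'; split=> //.
  by move=> k kb; apply/negP => ok; have := maxq' k; rewrite ok; nlia.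
(* The word at [q'.+1] mirrors the one at [q0.-1], which mirrors the one at [q.+1]. *)
have e1 := ufactor_mirror (k := q'.+1 - p) (l := q0.-1 - p) (m := N) m1.
have e2 := ufactor_mirror (k := 1) (l := q0.-1 - q) (m := N) m2.
move: eq; rewrite -[q.+1]addn1 e2; last nlia.
have -> : q'.+1 = p + (q'.+1 - p) by nlia.
rewrite e1; last nlia.
by rewrite (_ : q + _ = p + (q0.-1 - p)) //; nlia.
Qed.

(** An edge is read at two consecutive positions, the second word being reversed; recurrence puts
    them as far as wanted. *)
Lemma link_occ s t k : (size s.2).+1 = N -> link s t ->
  exists p, [/\ k <= p, occ u (vword s) p & occ u (vword t) p.+1].
Proof.
move=> sN [tr /(recur k)[p kp]]; rewrite /= size_rcons ufactorS => -[e1].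
move=> e2; exists p; split=> //; last first.
  by rewrite /occ /vword tr [size _]/= size_rev e2 rev_cons revK !inE eqxx orbT.
move: e2; rewrite ufactorSr => /rcons_inj[e2 _].
by rewrite /occ /= ufactorS e1 e2 inE eqxx.
Qed.

(** The edge from [d] to [y] sets the colour to [y]. Each edge of the walk to [z] is found further
    on in [u], and [color_const] carries the colour across the gaps. *)
Lemma no_cycle : ~ cycle_at link d.
Proof.
case=> y [z [dy dz yz r]]; apply: yz.
have tag s t : s.2 \in [:: d.2; rev d.2] -> link s t -> t.2 \in [:: d.2; rev d.2].
  by move=> sd [-> _]; rewrite mem_rev2.
have tagd : d.2 \in [:: d.2; rev d.2] by rewrite inE eqxx.
have tsz s : s.2 \in [:: d.2; rev d.2] -> size (vword s) = N.
  by rewrite -dN !inE => /orP[]/eqP /= ->; rewrite ?size_rev.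
have tneq s : s.2 \in [:: d.2; rev d.2] -> s <> d ->
    vword s \notin [:: vword d; rev (vword d)].
  by move=> sd sn; apply/negP => /(vword_inj sd).
have occN s k : s.2 \in [:: d.2; rev d.2] -> s <> d -> occ u (vword s) k ->
    ~~ occ u (vword d) k.
  move=> sd sn; have := tneq _ sd sn; rewrite /occ (tsz _ sd) (tsz _ tagd).
  move=> sx sk; apply: contra sx => dk; move: sk dk; rewrite !inE => /orP[]/eqP->; rewrite ?revK //.
  by rewrite (can_eq revK) (can2_eq revK revK) orbC.
have ty := tag _ _ tagd dy; have tz := tag _ _ tagd dz.
have reached : exists p, occ u (vword z) p /\ color p (vword y).
  suff: z.2 \in [:: d.2; rev d.2] /\ exists p, occ u (vword z) p /\ color p (vword y) by case.
  elim: r => [yd|s t rs [ts [p [sp cp]]] st td].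
    split=> //; have [p [_ dp yp]] := link_occ 0 dN dy.
    exists p.+1; split=> //; exists p; split=> //.
      by move=> k kb; rewrite (_ : k = p.+1); [exact: occN yp|nlia].
    by move: yp; rewrite /occ (tsz _ ty).
  have tt := tag _ _ ts st; split=> //.
  have sN : (size s.2).+1 = N := tsz _ ts.
  have sd : s <> d := reach_ok rs.
  have [p1 [pp1 sp1 tp1]] := link_occ p.+1 sN st.
  exists p1.+1; split=> //.
  have [q [q1 q2 q3 q4]] := color_const (tsz _ ts) (tneq _ ts sd) pp1 sp sp1 cp.
  exists q; split=> //; first nlia.
  move=> k kb; case: (ltnP p1 k) => kp; last by apply: q3; nlia.
  by rewrite (_ : k = p1.+1); [exact: occN tp1|nlia].
have [p [zp cp]] := reached.
have zd := reach_ok r.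
(* Right after this visit to [vword d] the colour is [z] by definition. *)
have [p2 [pp2 dp2 zp2]] := link_occ p.+1 dN dz.
have [q [q1 q2 q3 q4]] : color p2.+1 (vword y).
  by apply: (color_const (tsz _ tz) (tneq _ tz zd) _ zp zp2 cp); nlia.
have eq : q = p2.
  case: (ltngtP q p2) => // h; first by have := q3 p2; rewrite dp2 => /(_ _)/negP; case=> //; nlia.
  have {}h : q = p2.+1 by nlia.
  by have := occN _ _ tz zd zp2; rewrite -h q2.
rewrite eq in q4; move: zp2; rewrite /occ (tsz _ tz) => zp2.
apply: vword_inj.
  by move: ty tz; rewrite !inE => /orP[]/eqP-> /orP[]/eqP->; rewrite ?revK eqxx ?orbT.
move: q4 zp2; rewrite !inE => /orP[]/eqP->.
  by [].
by rewrite (can_eq revK) (can2_eq revK revK) orbC.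
Qed.

End Forest.

(** * Non-palindromic return words yield cycles *)

Section AcyclicReturns.
Variables (A : finType) (u : nat -> A).
Hypotheses (revc : forall w, fac u w -> fac u (rev w))
  (acyc : forall a w, w <> [::] -> ~ cycle_at (link u) (a, w))
  (acyc0 : all_return_words_to_letters_pal u \/
           forall a, ~ cycle_at (link u) (a, [::])).

Lemma link_at s n : link u (u s, ufactor u s.+1 n) (u (s.+1 + n), rev (ufactor u s.+1 n)).
Proof. by split=> //=; rewrite -ufactorSr -ufactorS; apply: fac_ufactor. Qed.

Lemma occ_behead a t s : ufactor u s (size t).+1 = a :: t -> ufactor u s.+1 (size t) = t.
Proof. by rewrite ufactorS => -[]. Qed.

(** Inside a return word to [a :: t], those to [t] are shorter, hence palindromic, and trace a walk
    in [link] from the letter [b] after the first occurrence to the letter [c] before the last. If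
    [b = c], pass to [a :: rcons t b]; otherwise the walk closes a cycle. *)
Lemma acyclic_ret_pal v : ret_pal u v.
Proof.
suff main L n p q : q - p < n -> q - p + size v = L -> p < q ->
    occ u v p -> occ u v q -> (forall s, p < s < q -> ~~ occ u v s) ->
    palindrome (ufactor u p L).
  by move=> p q pq op oq cons; apply: (main _ _ p q (ltnSn (q - p))).
(* The outer induction is on the length of the return word; the inner one, on [q - p], lets [v] grow
   at fixed length. *)
elim/ltn_ind: L n v p q => L IHL; elim=> // n IHn v p q le_n eL pq.
wlog vp : v eL / ufactor u p (size v) = v.
  move=> H op oq cons; move: (op); rewrite /occ !inE => /orP[]/eqP vp; first exact: (H v).
  apply: (H (rev v)); rewrite ?size_rev ?occ_rev //.
  by move=> s /cons; rewrite occ_rev.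
case: v eL vp => [|a t] eL vp op oq cons.
  have q1 : q <= p.+1.
    rewrite leqNgt; apply/negP => h; have := cons p.+1.
    by rewrite ltnSn h /occ inE eqxx => /(_ isT).
  have -> : L = 1 by move: eL => /=; lia.
  exact/eqP.
rewrite /= in eL vp.
have t1 : ufactor u p.+1 (size t) = t := occ_behead vp.
have up : u p = a by move: vp; rewrite ufactorS => -[].
(* If [v] itself occurs at [q], the palindromic return word to [t] ending with it starts with
   [rev v], so it starts at [q]. *)
have qv : ufactor u q (size t).+1 = rcons (rev t) a.
  move: (oq); rewrite /occ /= !inE rev_cons => /orP[]/eqP // qv.
  have uq : u q = a by move: qv; rewrite ufactorS => -[].
  have t2 := occ_behead qv.
  have ex : exists s, (s < q.+1) && occ u t s.
    by exists p.+1; rewrite ltnS pq /occ t1 inE eqxx.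
  case: (ex_maxnP ex (m := q)) => [s /andP[]//|s /andP[sq os] maxs].
  have ps : p < s by apply: maxs; rewrite ltnS pq /occ t1 inE eqxx.
  have oqt : occ u t q.+1 by rewrite /occ t2 inE eqxx.
  have pal : palindrome (ufactor u s (q.+1 - s + size t)).
    apply: (IHL _ _ _ t s q.+1 (ltnSn _)) => //; first lia.
    move=> k kb; apply/negP => ok.
    by have := maxs k; rewrite ok; lia.
  have m : ufactor u s (q.+1 - s + size t) = rev (ufactor u s (q.+1 - s + size t)) by apply/eqP.
  have e : ufactor u s (size t).+1 = rcons (rev t) a.
    rewrite -[s in LHS]addn0 (ufactor_mirror (l := q - s) m); last lia.
    by rewrite subnKC ?qv ?rev_cons //; lia.
  have os' : occ u (a :: t) s by rewrite /occ /= e rev_cons !inE eqxx orbT.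
  move: sq; rewrite ltnS leq_eqVlt => /predU1P[<-//|sq].
  by have := cons s; rewrite ps sq os' => /(_ isT).
have qt : ufactor u q (size t) = rev t by move: qv; rewrite ufactorSr => /rcons_inj[].
have uqt : u (q + size t) = a by move: qv; rewrite ufactorSr => /rcons_inj[].
case: (ltngtP p.+1 q) => [pq1|qp1|pq1]; [|lia|]; last first.
  have -> : L = (size t).+2 by lia.
  have et : t = rev t by rewrite -qt -pq1.
  by rewrite /palindrome ufactorS up pq1 qv rev_cons rev_rcons revK -et.
pose d := (a, t); set b := u (p.+1 + size t); set c := u q.-1.
have nd s : p < s < q -> occ u t s -> (u (s + size t), rev (ufactor u s (size t))) <> d.
  move=> sb os [e1 e2]; have := cons _ sb.
  by rewrite /occ /= ufactorSr e1 -[ufactor u s _]revK e2 rev_cons !inE eqxx orbT.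
have reached s : p < s < q -> occ u t s ->
    reach (link u) (fun x => x <> d) (b, rev t) (u (s + size t), rev (ufactor u s (size t))).
  elim/ltn_ind: s => s IHs sb os.
  case: (ltngtP p.+1 s) => [ps|ps|ps]; [|lia|]; last first.
    rewrite -ps t1 -/b; constructor=> bd.
    by apply: (nd s) => //; rewrite -ps t1.
  have ex : exists k, (k < s) && occ u t k.
    by exists p.+1; rewrite ps /occ t1 inE eqxx.
  case: (ex_maxnP ex (m := s)) => [k /andP[/ltnW]//|k /andP[ks ok] maxk].
  have pk : p < k by apply: maxk; rewrite ps /occ t1 inE eqxx.
  have m : ufactor u k (s - k + size t) = rev (ufactor u k (s - k + size t)).
    apply/eqP; apply: (IHL _ _ _ t k s (ltnSn _)) => //; first lia.
    move=> h hb; apply/negP => oh.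
    by have := maxk h; rewrite oh; lia.
  apply: reach_step (IHs k ks _ ok) _ (nd _ sb os); first lia.
  have := link_at s.-1 (size t); rewrite prednK; last lia.
  have -> : u s.-1 = u (k + size t).
    by have /ufactor_revP := m; move/(_ (s.-1 - k) (size t)) => <-; [congr u|]; lia.
  have es : ufactor u s (size t) = rev (ufactor u k (size t)).
    rewrite -[s in LHS](subnKC (ltnW ks)) (ufactor_mirror (l := 0) m) ?addn0 //.
  by rewrite {1}es.
have oq' : occ u t q by rewrite /occ qt !inE eqxx orbT.
have ex : exists k, (k < q) && occ u t k.
  by exists p.+1; rewrite pq1 /occ t1 inE eqxx.
case: (ex_maxnP ex (m := q)) => [k /andP[/ltnW]//|k /andP[kq ok] maxk].
have pk : p < k by apply: maxk; rewrite pq1 /occ t1 inE eqxx.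
have m : ufactor u k (q - k + size t) = rev (ufactor u k (q - k + size t)).
  apply/eqP; apply: (IHL _ _ _ t k q (ltnSn _)) => //; first lia.
  move=> h hb; apply/negP => oh.
  by have := maxk h; rewrite oh; lia.
have cE : u (k + size t) = c.
  by have /ufactor_revP := m; move/(_ (size t) (q.-1 - k)) => ->; [congr u|]; lia.
have tE : ufactor u k (size t) = t.
  rewrite -[RHS]revK -qt -(subnKC (ltnW kq)) (ufactor_mirror (l := 0) m); last lia.
  by rewrite revK addn0.
have rbc := reached k; rewrite pk kq ok cE tE in rbc.
have {}rbc := rbc isT isT.
case: (eqVneq b c) => [bc|bc].
  have v2 : ufactor u p (size t).+2 = a :: rcons t b.
    by rewrite ufactorS up ufactorSr t1.
  have v2' : ufactor u q.-1 (size t).+2 = rev (a :: rcons t b).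
    by rewrite ufactorS prednK ?qv -/c -?bc ?rev_cons ?rev_rcons //; lia.
  apply: (IHn (a :: rcons t b) p q.-1); rewrite /= ?size_rcons; try lia.
  - by rewrite /occ /= size_rcons v2 inE eqxx.
  - by rewrite /occ [size _]/= size_rcons v2' !inE eqxx orbT.
  move=> s sb; apply/negP; rewrite /occ [size _]/= size_rcons !inE => /orP[]/eqP e.
    have sq : p < s < q by lia.
    apply: (negP (cons s sq)).
    by case/(@ufactor_rcons _ _ _ _ (a :: t)): e => e _; rewrite /occ [size _]/= e inE eqxx.
  have sq : p < s.+1 < q by lia.
  apply: (negP (cons s.+1 sq)).
  move: e; rewrite ufactorS rev_cons rev_rcons => -[_ e].
  by rewrite /occ [size _]/= e rev_cons !inE eqxx orbT.
have cyc : cycle_at (link u) (a, t).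
  exists (b, rev t), (c, rev t); split=> //.
  - split=> //=; have := fac_ufactor u p (size t).+2.
    by rewrite ufactorS up ufactorSr t1.
  - split=> //=; rewrite -[_ :: _]revK; apply: revc.
    rewrite rev_cons rev_rcons rcons_cons -qv.
    have := fac_ufactor u q.-1 (size t).+2; rewrite ufactorS prednK //; lia.
  by case=> e; rewrite e eqxx in bc.
(* Only the empty [t] may carry a cycle, and then the return word is one to a letter. *)
case: (eqVneq t [::]) => [t0|/eqP t0]; last by case: (acyc t0 cyc).
case: acyc0 => [letters|nc]; last by case: (nc a); rewrite -t0.
move: cons up qv eL; rewrite t0 /= => cons up qv eL.
have uq : u q = a by move: qv; rewrite ufactorS => -[].
have -> : L = (q - p).+1 by lia.
apply: letters; rewrite ?up ?uq // => h hb ha.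
by apply: (negP (cons h hb)); rewrite /occ ufactorS ha inE eqxx.
Qed.

End AcyclicReturns.

(** * Morphisms and uniform recurrence *)

Section Morphisms.
Variable A : finType.
Implicit Types (f g phi : A -> seq A) (v w s t W : seq A).

Lemma mapw_cat f s t : mapw f (s ++ t) = mapw f s ++ mapw f t.
Proof. by rewrite /mapw map_cat flatten_cat. Qed.

Lemma mapw_cons f a s : mapw f (a :: s) = f a ++ mapw f s.
Proof. by []. Qed.

Lemma iter_mapw_cat f n s t :
  iter n (mapw f) (s ++ t) = iter n (mapw f) s ++ iter n (mapw f) t.
Proof. by elim: n => //= n ->; rewrite mapw_cat. Qed.

Lemma iter_mapw_nil f n : iter n (mapw f) [::] = [::].
Proof. by elim: n => //= n ->. Qed.

Lemma mapw_rev f s : mapw (fun a => rev (f a)) (rev s) = rev (mapw f s).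
Proof.
elim: s => //= a s IH.
by rewrite rev_cons -cats1 mapw_cat IH mapw_cons rev_cat /mapw /= cats0.
Qed.

Lemma iter_mapwE f n s :
  iter n (mapw f) s = mapw (fun a => iter n (mapw f) [:: a]) s.
Proof.
elim: s => [|a s IH]; first exact: iter_mapw_nil.
by rewrite -cat1s iter_mapw_cat IH mapw_cons.
Qed.

Lemma conj_mapw f g W : (forall a, f a ++ W = W ++ g a) ->
  forall w, mapw f w ++ W = W ++ mapw g w.
Proof.
move=> fg; elim=> [|a w IH]; first by rewrite /= cats0.
by rewrite !mapw_cons -catA IH catA fg -catA.
Qed.

(* When f is conjugate to g by W, f w ++ W = W ++ g w: this is the map on
   bispecial factors. *)
Definition bisp f W w := mapw f w ++ W.

(** Iterates of [bisp] keep its form: an iterated morphism followed by a fixed tail. *)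
Lemma iter_bispl f W n w :
  iter n (bisp f W) w = iter n (mapw f) w ++ iter n (bisp f W) [::].
Proof. by elim: n => [|n IH]; rewrite ?cats0 //= {1}/bisp IH mapw_cat -catA. Qed.

Lemma iter_bispr f g W n w : (forall a, f a ++ W = W ++ g a) ->
  iter n (bisp f W) w = iter n (bisp f W) [::] ++ iter n (mapw g) w.
Proof.
move=> /conj_mapw fg; elim: n => [//|n IH] /=.
by rewrite {1}/bisp IH mapw_cat -catA fg catA.
Qed.

Lemma size_conj_iter f g W n w : (forall a, f a ++ W = W ++ g a) ->
  size (iter n (mapw f) w) = size (iter n (mapw g) w).
Proof.
move=> fg; have := congr1 size (iter_bispr n w fg).
by rewrite iter_bispl !size_cat; lia.
Qed.

Lemma size_mapw f c w : (forall a, c <= size (f a)) -> c * size w <= size (mapw f w).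
Proof.
move=> fc; elim: w => [|a w IH]; first by rewrite muln0.
by rewrite mapw_cons size_cat /=; have := fc a; lia.
Qed.

(** * Primitive morphisms: growth and uniform recurrence *)

Section Primitive.
Variables (phi : A -> seq A) (K : nat).
Hypotheses (prim : forall a b : A, b \in iter K (mapw phi) [:: a])
  (two : exists a b : A, a <> b).

Lemma primitive_exp_gt0 : 0 < K.
Proof.
case: two => a [b ab]; rewrite lt0n; apply/eqP => K0; apply: ab.
by have := prim a b; rewrite K0 inE => /eqP.
Qed.

Lemma primitive_size2 a : 2 <= size (iter K (mapw phi) [:: a]).
Proof.
case: two => b [c bc].
have := prim a b; have := prim a c; case: (iter _ _ _) => [//|x [|y s]] //.
by rewrite !inE => /eqP xc /eqP xb; case: bc; rewrite xb xc.
Qed.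

Lemma primitive_nonerasing a : 0 < size (phi a).
Proof.
rewrite lt0n size_eq0; apply/eqP => e.
have := primitive_size2 a; rewrite -(prednK primitive_exp_gt0) iterSr /mapw /= e.
by rewrite iter_mapw_nil.
Qed.

Lemma size_iter_mapw n w : size w <= size (iter n (mapw phi) w).
Proof.
elim: n => //= n IH; apply: leq_trans IH _.
rewrite -[X in X <= _]mul1n; apply: size_mapw; exact: primitive_nonerasing.
Qed.

Lemma size_iter_primitive n w : 2 ^ n * size w <= size (iter (n * K) (mapw phi) w).
Proof.
elim: n => [|n IH]; first by rewrite mul1n.
rewrite mulSn iterD expnS -mulnA; set w' := iter (n * K) _ _ in IH *.
have := @size_mapw (fun a => iter K (mapw phi) [:: a]) 2 w' primitive_size2.
by rewrite -iter_mapwE; lia.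
Qed.

Variable u : nat -> A.
Hypothesis fixu : fixed_point phi u.

Lemma iter_mapw_prefix m n : let p := iter m (mapw phi) (ufactor u 0 n) in
  p = ufactor u 0 (size p).
Proof.
elim: m => [|m IH]; first by rewrite /= size_ufactor.
by rewrite iterS IH; apply: (fixu.1 _).
Qed.

(** With exponent [T], the image of every letter contains [w], through a copy of the image of [u 0].
    These images have length at most [M] and tile [u], so a window of length [M + M] contains a
    whole one. *)
Lemma uniformly_recurrent w :
  fac u w -> exists N, forall i, infix w (ufactor u i N).
Proof.
case=> i0 wE; set n := i0 + size w; set T := n * K + K.
have blk b : infix w (iter T (mapw phi) [:: b]).
  rewrite /T iterD; case/splitPr: (prim b (u 0)) => s1 s2.
  rewrite -cat1s !iter_mapw_cat; apply: infix_catl; apply: infix_catr.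
  have := iter_mapw_prefix (n * K) 1; rewrite /= => ->.
  set S := size _.
  have nS : n < S.
    have := size_iter_primitive n (ufactor u 0 1); rewrite size_ufactor muln1.
    by apply: leq_trans; apply: ltn_expl.
  by apply/infix_ufactorP; exists i0; [|split=> //]; rewrite /n in nS; lia.
pose M := \max_b size (iter T (mapw phi) [:: b]).
have MB b : size (iter T (mapw phi) [:: b]) <= M by apply: (leq_bigmax b).
exists (M + M) => i.
have ex : exists j, i <= size (iter T (mapw phi) (ufactor u 0 j)).
  by exists i; apply: leq_trans (size_iter_mapw _ _); rewrite size_ufactor.
case: (ex_minnP ex) => j ij minj.
set s := size _ in ij.
have sM : s <= i + M.
  rewrite /s; case: j minj @s ij => [|j] minj s ij.
    by rewrite iter_mapw_nil.
  rewrite /s ufactorSr -cats1 iter_mapw_cat size_cat.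
  have := MB (u (0 + j)); case: (leqP i (size (iter T (mapw phi) (ufactor u 0 j)))).
    by move/minj; rewrite ltnn.
  by lia.
have := iter_mapw_prefix T j.+1.
rewrite ufactorSr -cats1 iter_mapw_cat iter_mapw_prefix -/s /= size_cat ufactorD size_ufactor.
set s' := size (iter T (mapw phi) [:: u j]).
move=> /catI[//|_ eb].
have := blk (u j); rewrite eb => /infix_ufactorP[k kb [wk ek]].
have s'M : s' <= M by apply: MB.
by apply/infix_ufactorP; exists k; [|split=> //]; lia.
Qed.

End Primitive.
End Morphisms.

(** * Images of extension graphs *)

Lemma infix_mid (T : finType) (p z q X m Y : seq T) :
  p ++ z ++ q = X ++ m ++ Y -> size p <= size X -> size q <= size Y -> infix m z.
Proof.
move=> e pX qY.
have [_ e1] : p = take (size p) X /\ z ++ q = drop (size p) X ++ m ++ Y.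
  apply: catI; first by rewrite size_takel.
  by rewrite e [RHS]catA cat_take_drop.
have sze := congr1 size e1; rewrite !size_cat size_drop in sze.
pose k := size Y - size q.
have [-> _] : z = drop (size p) X ++ m ++ take k Y /\ q = drop k Y.
  apply: catI; last by rewrite e1 -!catA cat_take_drop.
  by rewrite !size_cat size_drop size_takel /k; lia.
by apply/is_infixP; exists (drop (size p) X), (take k Y).
Qed.

(** Orbits have at most [#|T|] elements, so their lengths divide the factorial. *)
Lemma iter_inj_fact (T : finType) (f : T -> T) n x :
  injective f -> #|T|`! %| n -> iter n f x = x.
Proof.
move=> f_inj; have : order f x %| #|T|`!.
  by rewrite dvdn_fact // fingraph.order_gt0 max_card.
move=> /dvdn_trans h /h/dvdnP[k ->].
by rewrite iterM iter_fix // fingraph.iter_order.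
Qed.

Section Transfer.
Variables (A : finType) (u : nat -> A).
Implicit Types (a b : A) (v w : seq A).

Section Bispecial.
Variables (phi phiR phiL : A -> seq A) (W1 W2 : seq A) (piR piL : A -> A).
Hypotheses (fixu : fixed_point phi u) (ne : forall a, 0 < size (phi a))
  (recur : forall w k, fac u w -> exists2 i, k <= i & ufactor u i (size w) = w)
  (conjR : forall a, phiR a ++ W2 = W2 ++ phi a)
  (conjL : forall a, phi a ++ W1 = W1 ++ phiL a)
  (lastR : forall a, Lst phiR a = Some (piR a))
  (firstL : forall a, Fst phiL a = Some (piL a)).

(** Surround the occurrence by contexts [x] and [y]. The image under [phi], with [W2] put before and
    [W1] after, is an image under [phiR], then [W2 ++ W1], then an image under [phiL]; the contexts
    are long enough to absorb the added words. *)
Lemma bisp_ext w a b : fac u (a :: rcons w b) ->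
  fac u (piR a :: rcons (bisp phiR (W2 ++ W1) w) (piL b)).
Proof.
move=> /(recur (size W2))[i iW e].
set n := size _ in e.
pose x := ufactor u 0 i; pose y := ufactor u (i + n) (size W1).
have eZ : ufactor u 0 (i + n + size W1) = (x ++ a :: w) ++ (b :: y).
  by rewrite !ufactorD !add0n e -/x -/y -!catA /= -cats1 -catA.
have facZ : fac u (mapw phi (ufactor u 0 (i + n + size W1))).
  by rewrite (fixu.1 _); apply: fac_ufactor.
apply: fac_infix facZ.
have [ra era] : exists ra, phiR a = rcons ra (piR a).
  have := lastR a; rewrite /Lst; case/lastP: (phiR a) => // s c.
  by rewrite rev_rcons => -[->]; exists s.
have [lb elb] : exists lb, phiL b = piL b :: lb.
  by have := firstL b; rewrite /Fst; case: (phiL b) => // c s [->]; exists s.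
have szR c : 1 <= size (phiR c).
  by have := congr1 size (conjR c); rewrite !size_cat; have := ne c; lia.
have szL c : 1 <= size (phiL c).
  by have := congr1 size (conjL c); rewrite !size_cat; have := ne c; lia.
apply: (@infix_mid _ W2 _ W1 (mapw phiR x ++ ra) _ (lb ++ mapw phiL y)).
- rewrite eZ mapw_cat -catA (conj_mapw conjL) !catA -(conj_mapw conjR).
  rewrite mapw_cat !mapw_cons era elb /bisp -!cats1 -!catA /=.
  by rewrite -!catA.
- have := size_mapw x szR; rewrite size_cat mul1n size_ufactor; lia.
have := size_mapw y szL; rewrite size_cat mul1n size_ufactor; lia.
Qed.

Lemma iter_bisp_ext n w a b : fac u (a :: rcons w b) ->
  fac u (iter n piR a :: rcons (iter n (bisp phiR (W2 ++ W1)) w) (iter n piL b)).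
Proof. by move=> h; elim: n => // n; apply: bisp_ext. Qed.

End Bispecial.

Hypothesis revc : forall w, fac u w -> fac u (rev w).

(* The extension graph of w as a bipartite graph, left letters being tagged by
   [false]; for a palindrome w it is a double cover of [link]. *)
Definition blink w (s t : A * bool) := t.2 = ~~ s.2 /\
  fac u (if s.2 then t.1 :: rcons w s.1 else s.1 :: rcons w t.1).

Lemma cycle_blink a w : cycle_at (link u) (a, w) -> cycle_at (blink w) (a, false).
Proof.
have [pw|npw] := eqVneq w (rev w); last first.
  move=> cyc; pose f (s : A * seq A) := (s.1, s.2 != w).
  have -> : (a, false) = f (a, w) by rewrite /f eqxx.
  apply: (cycle_at_map (P := fun s => s.2 \in [:: w; rev w]) _ _ _ _ cyc).
  - by move=> x y xw [-> _]; rewrite mem_rev2.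
  - move=> [x v] [y v'] /= vw [/= -> fv]; move: vw fv.
    rewrite !inE => /orP[]/eqP-> fv; split=> /=.
    + by rewrite eqxx eq_sym npw.
    + by rewrite eqxx.
    + by rewrite revK eqxx eq_sym npw.
    by rewrite eq_sym npw; move/revc: fv; rewrite rev_cons rev_rcons rcons_cons revK.
  - move=> [x v] [y v'] /= xv yv [-> e]; move: xv yv e.
    rewrite !inE => /orP[]/eqP-> /orP[]/eqP-> //;
    by rewrite eqxx [rev w == w]eq_sym (negbTE npw).
  by rewrite inE eqxx.
case=> [[y v]] [[z v']] [[/= -> ay] [/= -> az] yz r].
rewrite -pw in yz r.
have yz' : y <> z by move=> E; apply: yz; rewrite E.
have sym b c : fac u (b :: rcons w c) -> fac u (c :: rcons w b).
  by move=> /revc; rewrite rev_cons rev_rcons rcons_cons -pw.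
have ok e : e <> (a, w) -> e.2 = w -> e.1 <> a.
  by case: e => e1 e2 h /= e2w e1a; apply: h; rewrite e1a e2w.
(* A walk lifts to the double cover from either side; [c] tells whether it changes sides. *)
have [] : exists c : bool, forall b : bool, reach (blink w) (fun s => s.1 <> a) (y, b) (z, b (+) c).
  suff [_ //] : (z, w).2 = w /\ exists c : bool, forall b : bool,
      reach (blink w) (fun s => s.1 <> a) (y, b) ((z, w).1, b (+) c).
  elim: r => [yd|s t rs [sw [c rc]] [ts st] td].
    split=> //; exists false => b; rewrite addbF; constructor; exact: (ok (y, w)).
  split; first by rewrite ts sw -pw.
  exists (~~ c) => b; apply: reach_step (rc b) _ _; last by apply: ok; rewrite ?ts ?sw.
  split=> /=; first exact: addbN.
  by rewrite sw in st; case: (b (+) c) => //; apply: sym.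
move=> c rc.
have weak s t : reach (blink w) (fun s => s.1 <> a) s t ->
    reach (blink w) (fun s => s <> (a, false)) s t.
  elim=> [h|t1 t2 _ r1 e12 h].
    by constructor=> E; apply: h; rewrite E.
  by apply: reach_step r1 e12 _ => E; apply: h; rewrite E.
exists (y, true), (z, true); split; [by split|by split|by case|].
have := weak _ _ (rc true); case: c rc => rc //= r1.
have za : z <> a by exact: reach_ok (rc true).
have ya : y <> a by exact: reach_start (rc true).
(* If it changes sides, both lifts are joined through [(a, true)], the other copy of [a]. *)
apply: reach_trans (weak _ _ (rc false)).
apply: reach_step (_ : blink w (a, true) (y, false)) _; last 2 first.
- by split=> //=; apply: sym.
- by case.
by apply: reach_step r1 _ _ => //; split=> //=; apply: sym.
Qed.

Lemma blink_sub w w' d :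
  (forall a b, fac u (a :: rcons w b) -> fac u (a :: rcons w' b)) ->
  cycle_at (blink w) d -> cycle_at (blink w') d.
Proof.
move=> ww'; apply: (@cycle_at_map _ _ _ _ id (fun=> True)) => //.
by move=> [x b] [y c] _ [/= -> h]; split=> //=; case: b h => /ww'.
Qed.

Lemma blink_cycle w a : w != rev w ->
  cycle_at (blink w) (a, false) -> cycle_at (link u) (a, w).
Proof.
move=> npw cyc; pose f (s : A * bool) := (s.1, if s.2 then rev w else w).
have -> : (a, w) = f (a, false) by [].
apply: (cycle_at_map (P := fun=> True) _ _ _ _ cyc) => //.
- move=> [x b] [y c] _ [/= -> h]; split; first by case: b {h}; rewrite /= ?revK.
  by case: b h => //= /revc; rewrite rev_cons rev_rcons rcons_cons.
move=> [x b] [y c] _ _ [-> /=]; case: b; case: c => // e.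
  by rewrite e eqxx in npw.
by rewrite -e eqxx in npw.
Qed.

End Transfer.

(** * Moving a cycle to arbitrarily long factors *)

Section Pumping.
Variables (A : finType) (u : nat -> A) (f g : A -> seq A) (V : seq A).
Variable Psi : seq A -> seq A.
Hypotheses (PsiL : forall w, Psi w = mapw f w ++ V)
  (PsiR : forall w, Psi w = V ++ mapw g w)
  (Psi_inj : injective Psi)
  (Psi_ext : forall w a b, fac u (a :: rcons w b) -> fac u (a :: rcons (Psi w) b))
  (Psi_size : forall w, 2 * size w <= size (Psi w))
  (revc : forall w, fac u w -> fac u (rev w))
  (letters : exists N, forall w b, fac u w -> N <= size w -> b \in w).

(** Equivalently, [V] and all words [f a ++ V] are palindromes. *)
Let class_P := [forall a, rev (f a) == g a] && (rev V == V).

Lemma class_P_rev w : class_P -> Psi (rev w) = rev (Psi w).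
Proof.
case/andP=> /forallP fg /eqP rV; rewrite PsiL PsiR rev_cat rV -mapw_rev; congr (_ ++ _).
rewrite -[in LHS](revK w); congr flatten; rewrite revK.
by apply: eq_map => a; rewrite -(eqP (fg a)) revK.
Qed.

(** Both forms of [Psi w] are cut into blocks of equal lengths, so comparing them letter by letter
    reaches every letter. *)
Lemma palindromic_class_P w : (forall b, b \in w) -> w = rev w ->
  Psi w = rev (Psi w) -> class_P.
Proof.
move=> allw pw; rewrite {1}PsiR PsiL rev_cat -mapw_rev -pw => e.
have [rV ew] : V = rev V /\ mapw g w = mapw (fun a => rev (f a)) w.
  by apply: catI e; rewrite size_rev.
have sz a : size (rev (f a)) = size (g a).
  have e1 : f a ++ V = V ++ g a.
    by have := PsiL [:: a]; rewrite PsiR /mapw /= !cats0.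
  by have := congr1 size e1; rewrite !size_cat size_rev; lia.
rewrite /class_P -rV eqxx andbT; apply/forallP => a; have := allw a.
elim: w ew {e allw pw} => // b w IH; rewrite !mapw_cons => /catI[//|eb ew].
rewrite inE => /predU1P[->|/IH-> //]; by rewrite eb.
Qed.

Let size_iter_Psi n w : 0 < size (Psi w) -> n <= size (iter n Psi w).
Proof.
move=> w0; elim: n => [//|[|n] IH //]; rewrite iterS.
by apply: leq_trans (Psi_size _); lia.
Qed.

Let iter_Psi_ext n w a b :
  fac u (a :: rcons w b) -> fac u (a :: rcons (iter n Psi w) b).
Proof. by move=> h; elim: n => //= n; apply: Psi_ext. Qed.

(** Under [class_P] the map [Psi] acts on [link]. Otherwise the cycle survives in the bipartite
    graphs of all iterates and returns to [link] at a non-palindrome; of two consecutive long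
    iterates, one is such. *)
Lemma cycle_pumping a w H : 0 < size (Psi w) -> cycle_at (link u) (a, w) ->
  exists d, H <= size d.2 /\ cycle_at (link u) d.
Proof.
move=> w0 cyc; have [cP|ncP] := boolP class_P.
  exists (a, iter H Psi w); split; first exact: size_iter_Psi.
  elim: H => //= n IH; pose F (s : A * seq A) := (s.1, Psi s.2).
  have -> : (a, Psi (iter n Psi w)) = F (a, iter n Psi w) by [].
  apply: (cycle_at_map (P := fun=> True) _ _ _ _ IH) => //.
    move=> s t _ [ts st]; split; first by rewrite /= ts class_P_rev.
    exact: Psi_ext.
  by move=> [x v] [y v'] _ _ [-> /Psi_inj->].
have [N letN] := letters.
have bl n : cycle_at (blink u (iter n Psi w)) (a, false).
  by apply: blink_sub (cycle_blink revc cyc) => x y; apply: iter_Psi_ext.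
have [n Hn Nn] : exists2 n, H <= n & N <= n.
  by exists (H + N); rewrite ?leq_addr ?leq_addl.
have sz := size_iter_Psi n w0.
have sz' : n.+1 <= size (iter n.+1 Psi w) := size_iter_Psi n.+1 w0.
have [p1|np] := eqVneq (iter n Psi w) (rev (iter n Psi w)); last first.
  exists (a, iter n Psi w); split; first exact: leq_trans Hn sz.
  exact: blink_cycle.
exists (a, iter n.+1 Psi w); split; first exact: leq_trans (leqW Hn) sz'.
apply: blink_cycle => //; apply: contra ncP => /eqP.
apply: palindromic_class_P => // b.
apply: letN; last exact: leq_trans Nn sz.
have [y [z [[_ ay] _ _ _]]] := cyc.
have := iter_Psi_ext n ay; move/(fac_infix _); apply.
by rewrite -cats1 -cat1s; apply: infix_infix.
Qed.

End Pumping.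

(** * The suitable power of the bispecial map, and the case of the empty word *)

Theorem theorem1 (A : finType) (phi : A -> seq A) (u : nat -> A) :
  primitive phi -> marked phi -> fixed_point phi u -> finite_defect u ->
  (all_return_words_to_letters_pal u \/
   (exists psi : A -> seq A, conjugate psi phi /\ ~ (forall a, psi a = phi a))) ->
  zero_defect u.
Proof.
case=> K prim [_ [[psiL [[[W1 conjL] [a0 [b0 ab0]]] injL]] [psiR [[[W2 conjR] ncR] injR]]]].
move=> fixu fd hyp.
have two : exists a b : A, a <> b by exists a0, b0 => E; apply: ab0; rewrite E.
have K0 := primitive_exp_gt0 prim two.
have ne := primitive_nonerasing prim two.
have urec := uniformly_recurrent prim two fixu.
have recur w k : fac u w -> exists2 i, k <= i & ufactor u i (size w) = w.
  case/urec=> N /(_ k)/infix_ufactorP[i ik [_ e]].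
  by exists i => //; case/andP: ik.
have [n0 new] := finite_defect_new_pal fd.
have revc := new_pal_rev_closed new recur urec.
have long d : n0 <= size d.2 -> ~ cycle_at (link u) d.
  move=> nd; apply: (no_cycle (N := (size d.2).+1)) => // v sv.
  by apply: new_pal_ret_pal new _; lia.
have letters : exists N, forall w b, fac u w -> N <= size w -> b \in w.
  have [|N wN] := urec (iter K (mapw phi) (ufactor u 0 1)).
    by rewrite (iter_mapw_prefix fixu); apply: fac_ufactor.
  exists N => w b [i <-]; rewrite size_ufactor => Nw.
  have := prim (u 0) b; have /infixW/mem_subseq := wN i; rewrite ufactorS /= => h /h.
  by rewrite -(subnKC Nw) ufactorD mem_cat => ->.
have firstE a : exists c, Fst psiL a = Some c.
  have := congr1 size (conjL a); rewrite !size_cat; have := ne a; rewrite /Fst.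
  by case: (psiL a) => [|c s] /=; [lia|exists c].
have lastE a : exists c, Lst psiR a = Some c.
  have := congr1 size (conjR a); rewrite !size_cat; have := ne a; rewrite /Lst.
  by case/lastP: (psiR a) => [|s c] /=; [lia|rewrite rev_rcons; exists c].
(* The default [a0] is never reached, as the images are nonempty. *)
pose piL a := odflt a0 (Fst psiL a); pose piR a := odflt a0 (Lst psiR a).
have piLE a : Fst psiL a = Some (piL a) by rewrite /piL; case: (firstE a) => c ->.
have piRE a : Lst psiR a = Some (piR a) by rewrite /piR; case: (lastE a) => c ->.
have piL_inj : injective piL by move=> a b e; apply: injL; rewrite !piLE e.
have piR_inj : injective piR by move=> a b e; apply: injR; rewrite !piRE e.
(* The factorial makes the powers of [piL] and [piR] identities; the factor [K] makes lengths at
   least double. *)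
pose Phi := bisp psiR (W2 ++ W1); pose M := #|A|`! * K.
have conj a : psiR a ++ W2 ++ W1 = (W2 ++ W1) ++ psiL a.
  by rewrite catA conjR -catA conjL catA.
have MA : #|A|`! %| M by apply: dvdn_mulr.
have M0 : 0 < M by rewrite muln_gt0 fact_gt0 K0.
have Psi_ext w a b : fac u (a :: rcons w b) -> fac u (a :: rcons (iter M Phi w) b).
  move=> /(iter_bisp_ext fixu ne recur conjR conjL piRE piLE M).
  by rewrite !iter_inj_fact.
(* The words [psiL a] start with distinct letters, so they form a prefix code. *)
have Phi_inj : injective Phi.
  move=> v w; rewrite /Phi /bisp !(conj_mapw conj) => /catI[//|_].
  elim: v w => [|a v IH] [|b w] //; rewrite !mapw_cons.
  - by have := piLE b; rewrite /Fst; case: (psiL b).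
  - by have := piLE a; rewrite /Fst; case: (psiL a).
  have ab : forall s t, psiL a ++ s = psiL b ++ t -> a = b.
    move=> s t; have := piLE a; have := piLE b; rewrite /Fst.
    case: (psiL a) => // c1 s1; case: (psiL b) => // c2 s2 [e2] [e1] [e _].
    by apply: piL_inj; rewrite -e1 -e2.
  by move=> e; have eab := ab _ _ e; move: e; rewrite -eab => /catI[//|_ /IH->].
have Psi_size w : 2 * size w <= size (iter M Phi w).
  rewrite iter_bispl size_cat (size_conj_iter _ _ conjR).
  have := size_iter_primitive prim two #|A|`! w; rewrite -/M.
  have : 2 <= 2 ^ #|A|`! by rewrite -[X in X <= _]expn1 leq_exp2l // fact_gt0.
  by nia.
have PsiL w : iter M Phi w =
    mapw (fun a => iter M (mapw psiR) [:: a]) w ++ iter M Phi [::].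
  by rewrite iter_bispl -iter_mapwE.
have PsiR w : iter M Phi w =
    iter M Phi [::] ++ mapw (fun a => iter M (mapw psiL) [:: a]) w.
  by rewrite (iter_bispr M w conj) -iter_mapwE.
have Psi_inj : injective (iter M Phi).
  by elim: (M) => // n IH v v' /= /Phi_inj/IH.
have nocyc a w : 0 < size (iter M Phi w) -> ~ cycle_at (link u) (a, w).
  move=> w0 cyc.
  have [d [nd cd]] := cycle_pumping PsiL PsiR Psi_inj Psi_ext Psi_size revc letters n0 w0 cyc.
  exact: long nd cd.
apply: ret_pal_zero_defect; apply: acyclic_ret_pal => //.
  by move=> a w w0; apply: nocyc; apply: leq_trans (Psi_size w); case: w w0.
case: hyp => [|[psi [psi_conj npsi]]]; [by left|right=> a].
apply: nocyc; rewrite -(prednK M0) iterS size_cat.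
suff: 0 < size (W2 ++ W1) by lia.
(* If [W1] and [W2] were empty, [phi] would be its own leftmost and rightmost conjugate; a nonempty
   conjugating word would make its first or last letters constant. *)
rewrite lt0n; apply/eqP => /size0nil/nilP; rewrite cat_nilp => /andP[/nilP W20 /nilP W10].
have phiL b : psiL b = phi b by have := conjL b; rewrite W10 cats0.
have phiR b : psiR b = phi b by have := conjR b; rewrite W20 cats0.
apply: npsi; case: psi_conj => -[w cw].
  case: w cw => [|x w] cw b; first by have := cw b; rewrite cats0.
  have first_x c : Fst psiL c = Some x.
    by have := cw c; rewrite /Fst phiL; have := ne c; case: (phi c) => //= y s _ [->].
  by case: ab0; rewrite !first_x.
case/lastP: w cw => [|w x] cw b; first by have := cw b; rewrite cats0.
have last_x c : Lst psiR c = Some x.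
  have := cw c; rewrite /Lst phiR; have := ne c.
  case/lastP: (phi c) => // s y _; rewrite -rcons_cat -rcons_cat => /rcons_inj[_ ->].
  by rewrite rev_rcons.
by case: ncR => c [c' []]; rewrite !last_x.
Qed.
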